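(* Let $G$ be a connected three-dimensional Lie group with Lie algebra $\mathfrak{g}$, and let $g$ be a left-invariant Riemannian metric on $G$ carrying a non-zero invariant generalised Killing spinor with associated endomorphism $A$. Then every invariant spinor is generalised Killing with endomorphism $A$.
   Context: Spinors. Let $G$ be a connected three-dimensional Lie group with an orientation and a left-invariant Riemannian metric $g$, corresponding to an inner product $B$ on the Lie algebra $\mathfrak g$. Fix a (positively oriented) $B$-orthonormal basis $(e_1,e_2,e_3)$ of $\mathfrak g$, identified with left-invariant vector fields. The spin structure used is the $G$-invariant one, i.e. the trivial one determined by the global left-invariant orthonormal frame. The spinor bundle is $G\times\Sigma$, where $\Sigma=\mathrm{span}_{\mathbb C}\{1,y_1\}\cong\mathbb C^2$, with Clifford multiplication $$e_1\cdot 1=i\,1,\quad e_1\cdot y_1=-i\,y_1,\quad e_2\cdot 1=i\,y_1,\quad e_2\cdot y_1=i\,1,\quad e_3\cdot 1=y_1,\quad e_3\cdot y_1=-1$$ (so $v\cdot v\cdot\psi=-B(v,v)\psi$). A spinor is a smooth map $\psi:G\to\Sigma$; it is invariant if it is constant, so invariant spinors are identified with elements of $\Sigma$. The spin connection $\widetilde\nabla^g$ is the lift of the Levi-Civita connection $\nabla^g$; for an invariant spinor $\psi\in\Sigma$ and $X\in\mathfrak g$, $\widetilde\nabla^g_X\psi=\frac12\sum_{i<j}g(\nabla^g_Xe_i,e_j)\,e_i\cdot e_j\cdot\psi$. Generalised Killing spinors. A spinor $\psi$ is generalised Killing with (associated) endomorphism $A$ if $A$ is a $g$-symmetric endomorphism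 field of $TG$ with $\widetilde\nabla^g_X\psi=A(X)\cdot\psi$ for every vector field $X$. *)

(* Defs.v *)
From HB Require Import structures.
From mathcomp Require Import all_boot all_order all_algebra.
From mathcomp Require Import complex.
From mathcomp Require Import all_classical all_reals all_analysis.
Set Implicit Arguments.
Unset Strict Implicit.
Unset Printing Implicit Defensive.
Import Order.TTheory GRing.Theory Num.Theory.
Import numFieldNormedType.Exports.
Local Open Scope classical_set_scope.
Local Open Scope ring_scope.

(* [Ck k U f]: on the open set [U], all iterated directional derivatives of [f]
   of order at most [k] exist and are continuous. *)
Fixpoint Ck (R : realType) (V W : normedModType R) (k : nat) (U : set V)
    (f : V -> W) : Prop :=
  (forall x, U x -> {for x, continuous f}) /\
  if k is k'.+1 then
    (forall x v, U x -> derivable f x v) /\ (forall v, Ck k' U ('D_v f))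
  else True.

Definition smooth_on (R : realType) (V W : normedModType R) (U : set V)
    (f : V -> W) : Prop := forall k, Ck k U f.

(* Outside [chart_dom] (resp. its image) [chart_map] (resp. [chart_inv]) takes
   arbitrary values. *)
Record chart (R : realType) (n : nat) (T : topologicalType) := Chart {
  chart_dom : set T ;
  chart_map : T -> 'rV[R]_n ;
  chart_inv : 'rV[R]_n -> T ;
  chart_dom_open : open chart_dom ;
  chart_img_open : open (chart_map @` chart_dom) ;
  chart_mapK : forall x, chart_dom x -> chart_inv (chart_map x) = x ;
  chart_map_continuous : forall x, chart_dom x -> {for x, continuous chart_map} ;
  chart_inv_continuous : forall y, (chart_map @` chart_dom) y ->
    {for y, continuous chart_inv} }.

Definition chart_img (R : realType) (n : nat) (T : topologicalType)
    (c : chart R n T) : set 'rV[R]_n := chart_map c @` chart_dom c.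

HB.mixin Record isSmoothManifold (R : realType) (n : nat) T of Topological T := {
  atlas : set (chart R n T) ;
  manifold_hausdorff : hausdorff_space T ;
  manifold_second_countable : @second_countable T ;
  atlas_cover : forall x : T, exists2 c, atlas c & chart_dom c x ;
  atlas_compatible : forall c d, atlas c -> atlas d ->
    smooth_on (chart_map c @` (chart_dom c `&` chart_dom d))
              (chart_map d \o chart_inv c) }.

#[short(type="manifoldType")]
HB.structure Definition SmoothManifold (R : realType) (n : nat) :=
  { T of Topological T & isSmoothManifold R n T }.

(* Smoothness of [mul] and [inv] is stated in charts; continuity makes the
   domains of the local expressions open. *)
HB.mixin Record isLieGroup (R : realType) (n : nat) G
    of Group G & SmoothManifold R n G := {
  mulg_continuous : continuous (fun x : G * G => (x.1 * x.2)%g) ;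
  invg_continuous : continuous (fun x : G => (x^-1)%g) ;
  mulg_smooth : forall a b c : chart R n G, atlas a -> atlas b -> atlas c ->
    smooth_on [set z : 'rV[R]_n * 'rV[R]_n |
                [/\ chart_img a z.1, chart_img b z.2 &
                    chart_dom c (chart_inv a z.1 * chart_inv b z.2)%g]]
      (fun z => chart_map c (chart_inv a z.1 * chart_inv b z.2)%g) ;
  invg_smooth : forall a c : chart R n G, atlas a -> atlas c ->
    smooth_on [set z | chart_img a z /\ chart_dom c ((chart_inv a z)^-1)%g]
      (fun z => chart_map c ((chart_inv a z)^-1)%g) }.

#[short(type="lieGroupType")]
HB.structure Definition LieGroup (R : realType) (n : nat) :=
  { G of Group G & SmoothManifold R n G & isLieGroup R n G }.

Section CkTheory.
Context {R : realType} {V : normedModType R}.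
Implicit Types (U : set V) (f g : V -> R).

Lemma near_on_open {W : Type} U (f g : V -> W) x : open U -> U x ->
  (forall y, U y -> f y = g y) -> \near x, f x = g x.
Proof.
move=> oU Ux fg; have := open_nbhs_nbhs (conj oU Ux).
exact: filterS.
Qed.

Lemma near_eq_continuous {W : normedModType R} (f g : V -> W) x :
  (\near x, f x = g x) -> {for x, continuous f} -> {for x, continuous g}.
Proof.
move=> fg cf; have fgx : f x = g x by exact: nbhs_singleton fg.
rewrite /prop_for /continuous_at -fgx.
by apply: cvg_trans cf; exact: near_eq_cvg.
Qed.

Lemma Ck_ext {W : normedModType R} k U (f g : V -> W) : open U ->
  (forall x, U x -> f x = g x) -> Ck k U f -> Ck k U g.
Proof.
move=> oU; elim: k f g => [|k IH] f g fg [cf Hf].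
  split=> // x Ux; apply: near_eq_continuous (cf x Ux).
  exact: near_on_open fg.
split=> [x Ux|].
  by apply: near_eq_continuous (cf x Ux); exact: near_on_open fg.
have [df Df] := Hf; split=> [x v Ux|v].
  by apply: near_eq_derivable (df x v Ux); exact: near_on_open fg.
apply: IH (Df v) => x Ux.
by apply: near_eq_derive; exact: near_on_open fg.
Qed.

Lemma CkS {W : normedModType R} k U (f : V -> W) : Ck k.+1 U f -> Ck k U f.
Proof.
elim: k f => [|k IH] f; first by case.
by move=> [cf [df Df]]; split => //; split => // v; exact/IH/Df.
Qed.

Lemma Ck_cst k U (a : R) : Ck k U (cst a).
Proof.
elim: k a => [|k IH] a /=; first by split=> // x _; exact: cst_continuous.
split=> [x _|]; first exact: cst_continuous.
split=> [x v _|v]; first exact: derivable_cst.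
rewrite [X in Ck _ _ X](_ : _ = cst 0) //.
by apply/funext => x; rewrite derive_cst.
Qed.

Lemma CkD k U f g : open U -> Ck k U f -> Ck k U g -> Ck k U (f + g).
Proof.
move=> oU; elim: k f g => [|k IH] f g [cf Hf] [cg Hg].
  by split=> // x Ux; exact: continuousD (cf x Ux) (cg x Ux).
split=> [x Ux|]; first exact: continuousD (cf x Ux) (cg x Ux).
move: Hf Hg => [df Df] [dg Dg]; split=> [x v Ux|v].
  exact: derivableD (df x v Ux) (dg x v Ux).
apply: (Ck_ext (f := 'D_v f + 'D_v g)) => // [x Ux|]; last exact: IH (Df v) (Dg v).
by rewrite (deriveD (df x v Ux) (dg x v Ux)).
Qed.

Lemma CkM k U f g : open U -> Ck k U f -> Ck k U g -> Ck k U (f * g).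
Proof.
move=> oU; elim: k f g => [|k IH] f g Hf Hg.
  have [[cf _] [cg _]] := (Hf, Hg).
  by split=> // x Ux; exact: continuousM (cf x Ux) (cg x Ux).
have [[cf [df Df]] [cg [dg Dg]]] := (Hf, Hg).
split=> [x Ux|]; first exact: continuousM (cf x Ux) (cg x Ux).
split=> [x v Ux|v].
  exact: derivableM (df x v Ux) (dg x v Ux).
apply: (Ck_ext (f := f * 'D_v g + g * 'D_v f)) => // [x Ux|].
  by rewrite (deriveM (df x v Ux) (dg x v Ux)).
by apply: CkD => //; apply: IH; [exact: CkS|exact: Dg|exact: CkS|exact: Df].
Qed.

End CkTheory.

Section SmoothFunctions.
Context {R : realType} {n : nat} (M : manifoldType R n).

Definition smooth (f : M -> R) : Prop :=
  forall c, atlas c -> smooth_on (chart_img c) (f \o chart_inv c).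

Definition smooth_pred : {pred (M -> R)} := mem [set f | smooth f].

Lemma smoothP (f : M -> R) : reflect (smooth f) (f \in smooth_pred).
Proof. by apply: (iffP idP) => [/set_mem|?]; last exact/mem_set. Qed.

Lemma smooth_cst (a : R) : smooth (cst a).
Proof. by move=> c _ k; exact: Ck_cst. Qed.

Lemma smoothD (f g : M -> R) : smooth f -> smooth g -> smooth (f + g).
Proof.
move=> sf sg c Ac k.
by apply: CkD; [exact: chart_img_open|exact: sf|exact: sg].
Qed.

Lemma smoothM (f g : M -> R) : smooth f -> smooth g -> smooth (f * g).
Proof.
move=> sf sg c Ac k.
by apply: CkM; [exact: chart_img_open|exact: sf|exact: sg].
Qed.

Lemma smooth_subring_closed : subring_closed smooth_pred.
Proof.
have sN (f : M -> R) : smooth f -> smooth (- f).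
  have -> : - f = cst (-1) * f by apply/funext => x; rewrite fctE mulN1r.
  exact/smoothM/smooth_cst.
split=> [|f g /smoothP sf /smoothP sg|f g /smoothP sf /smoothP sg];
  apply/smoothP; [exact: smooth_cst|exact/smoothD/sN|exact: smoothM].
Qed.

Lemma smooth_scaler_closed : GRing.scaler_closed smooth_pred.
Proof.
move=> a f /smoothP sf; apply/smoothP.
have -> : a *: f = cst a * f by exact/funext.
exact/smoothM/sf/smooth_cst.
Qed.

HB.instance Definition _ :=
  GRing.isSubringClosed.Build (M -> R) smooth_pred smooth_subring_closed.
HB.instance Definition _ :=
  GRing.isScaleClosed.Build R (M -> R) smooth_pred smooth_scaler_closed.

Record smooth_fun := SmoothFun {
  smooth_fun_val :> M -> R ;
  smooth_fun_in : smooth_fun_val \in smooth_pred }.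

HB.instance Definition _ := [isSub for smooth_fun_val].
HB.instance Definition _ := [Choice of smooth_fun by <:].
HB.instance Definition _ := GRing.SubChoice_isSubComPzRing.Build
  (M -> R) smooth_pred smooth_fun (subringClosedP smooth_pred).
HB.instance Definition _ := [SubZmodule_isSubLmodule of smooth_fun by <:].

Definition mk_smooth (f : M -> R) (sf : smooth f) : smooth_fun :=
  SmoothFun (introT (smoothP f) sf).

End SmoothFunctions.
Arguments smooth_fun {R n} M.

#[local] Obligation Tactic := idtac.

Section VectorFields.
Context {R : realType} {n : nat} (M : manifoldType R n).
Local Notation C := (smooth_fun M).

Lemma smooth_fun_ext (f g : C) : (forall p, f p = g p) -> f = g.
Proof. by move=> fg; apply/val_inj/funext. Qed.

Lemma smooth_scaleAr (a : R) (f g : C) : f * (a *: g) = a *: (f * g).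
Proof.
by apply: smooth_fun_ext => p; exact: mulrCA.
Qed.

Record vector_field := VectorField {
  vf_fun :> C -> C ;
  vf_linear : linear vf_fun ;
  vf_leibniz : forall f g, vf_fun (f * g) = vf_fun f * g + f * vf_fun g }.

Lemma vf_ext (X Y : vector_field) : (forall f, X f = Y f) -> X = Y.
Proof.
case: X Y => [X lX dX] [Y lY dY] /= /funext XY.
rewrite -{Y}XY in lY dY *.
by congr VectorField; exact: Prop_irrelevance.
Qed.

Program Definition vf_zero := @VectorField (fun=> 0) _ _.
Next Obligation. by move=> a f g; rewrite scaler0 addr0. Qed.
Next Obligation. by move=> f g /=; rewrite mul0r mulr0 addr0. Qed.

Program Definition vf_add (X Y : vector_field) :=
  @VectorField (fun f => X f + Y f) _ _.
Next Obligation.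
by move=> X Y a f g; rewrite !vf_linear scalerDr addrACA.
Qed.
Next Obligation.
by move=> X Y f g /=; rewrite !vf_leibniz mulrDl mulrDr addrACA.
Qed.

Program Definition vf_opp (X : vector_field) :=
  @VectorField (fun f => - X f) _ _.
Next Obligation. by move=> X a f g; rewrite vf_linear opprD scalerN. Qed.
Next Obligation. by move=> X f g /=; rewrite vf_leibniz opprD mulNr mulrN. Qed.

Program Definition vf_scale (h : C) (X : vector_field) :=
  @VectorField (fun f => h * X f) _ _.
Next Obligation.
by move=> h X a f g; rewrite vf_linear mulrDr smooth_scaleAr.
Qed.
Next Obligation.
by move=> h X f g /=; rewrite vf_leibniz mulrDr mulrA [h * (f * _)]mulrCA.
Qed.

HB.instance Definition _ := gen_eqMixin vector_field.
HB.instance Definition _ := gen_choiceMixin vector_field.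

Program Definition vf_zmod :=
  @GRing.isZmodule.Build vector_field vf_zero vf_opp vf_add _ _ _ _.
Next Obligation. by move=> X Y Z; apply: vf_ext => f /=; rewrite addrA. Qed.
Next Obligation. by move=> X Y; apply: vf_ext => f /=; rewrite addrC. Qed.
Next Obligation. by move=> X; apply: vf_ext => f /=; rewrite add0r. Qed.
Next Obligation. by move=> X; apply: vf_ext => f /=; rewrite addNr. Qed.
HB.instance Definition _ := vf_zmod.

Program Definition vf_lmod :=
  @GRing.Zmodule_isLmodule.Build C vector_field vf_scale _ _ _ _.
Next Obligation. by move=> g h X; apply: vf_ext => f /=; rewrite mulrA. Qed.
Next Obligation. by move=> X; apply: vf_ext => f /=; rewrite mul1r. Qed.
Next Obligation. by move=> h X Y; apply: vf_ext => f /=; rewrite mulrDr. Qed.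
Next Obligation. by move=> X g h; apply: vf_ext => f /=; rewrite mulrDl. Qed.
HB.instance Definition _ := vf_lmod.

Program Definition lie_bracket (X Y : vector_field) :=
  @VectorField (fun f => X (Y f) - Y (X f)) _ _.
Next Obligation.
move=> X Y a f g.
by rewrite !vf_linear opprD addrACA scalerBr.
Qed.
Next Obligation.
move=> X Y f g /=.
have vfD (Z : vector_field) u v : Z (u + v) = Z u + Z v.
  by have := vf_linear Z 1 u v; rewrite !scale1r.
have cancel (a b c d a' d' : C) :
    a + b + (c + d) - (a' + c + (b + d')) = a - a' + (d - d').
  rewrite (addrC c d) (addrC b d') (addrACA a) (addrACA a') (addrC c b).
  by rewrite opprD (addrACA (a + d)) subrr addr0 opprD addrACA.
by rewrite !(vf_leibniz, vfD) mulrBl mulrBr cancel.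
Qed.

Record riemannian_metric := RiemannianMetric {
  metric_fun :> vector_field -> vector_field -> C ;
  metric_linear : forall h (X Y Z : vector_field),
    metric_fun (h *: X + Y) Z = h * metric_fun X Z + metric_fun Y Z ;
  metric_sym : forall X Y, metric_fun X Y = metric_fun Y X ;
  metric_pos : forall (X : vector_field) p, (exists f, X f p != 0) -> 0 < metric_fun X X p }.

Record levi_civita (g : riemannian_metric)
    (nabla : vector_field -> vector_field -> vector_field) : Prop := LeviCivita {
  connection_linear : forall h (X Y Z : vector_field),
    nabla (h *: X + Y) Z = h *: nabla X Z + nabla Y Z ;
  connection_additive : forall X Y Z : vector_field, nabla X (Y + Z) = nabla X Y + nabla X Z ;
  connection_leibniz : forall h (X Y : vector_field), nabla X (h *: Y) = X h *: Y + h *: nabla X Y ;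
  connection_metric : forall X Y Z : vector_field, X (g Y Z) = g (nabla X Y) Z + g Y (nabla X Z) ;
  connection_torsion_free : forall X Y : vector_field,
    nabla X Y - nabla Y X = lie_bracket X Y }.

(* [X] and [Y] are [F]-related: [dF (X p) = Y (F p)] for all [p], for a smooth
   map [F]. *)
Definition vf_related (F : M -> M) (X Y : vector_field) : Prop :=
  forall f h : C, (forall p, h p = f (F p)) -> forall p, X h p = Y f (F p).

End VectorFields.
Arguments vector_field {R n} M.
Arguments riemannian_metric {R n} M.

Section LeftInvariance.
Context {R : realType} {n : nat} (G : lieGroupType R n).

Definition left_invariant_field (X : vector_field G) : Prop :=
  forall a : G, vf_related (fun p : G => (a * p)%g) X X.

Definition left_invariant_metric (g : riemannian_metric G) : Prop :=
  forall (a : G) (X Y X' Y' : vector_field G),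
    vf_related (fun p : G => (a * p)%g) X X' ->
    vf_related (fun p : G => (a * p)%g) Y Y' ->
    forall p : G, g X' Y' (a * p)%g = g X Y p.

End LeftInvariance.

(* An orientation, represented by a nowhere vanishing 3-form. *)
Record orientation {R : realType} (M : manifoldType R 3) := Orientation {
  orientation_form :> vector_field M -> vector_field M -> vector_field M ->
    smooth_fun M ;
  orientation_linear : forall h (X X' Y Z : vector_field M),
    orientation_form (h *: X + X') Y Z =
    h * orientation_form X Y Z + orientation_form X' Y Z ;
  orientation_swap12 : forall X Y Z,
    orientation_form Y X Z = - orientation_form X Y Z ;
  orientation_swap23 : forall X Y Z,
    orientation_form X Z Y = - orientation_form X Y Z ;
  orientation_neq0 : forall p, exists X Y Z, orientation_form X Y Z p != 0 }.

Definition orthonormal_frame {R : realType} (M : manifoldType R 3)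
    (g : riemannian_metric M) (e : 'I_3 -> vector_field M) : Prop :=
  forall i j, g (e i) (e j) = (i == j)%:R.

Definition positively_oriented {R : realType} (M : manifoldType R 3)
    (omega : orientation M) (e : 'I_3 -> vector_field M) : Prop :=
  forall p, 0 < omega (e 0) (e 1) (e 2) p.

Local Notation Sigma R := 'cV[R[i]]_2.

Section CliffordModule.
Context {R : realType}.

Definition sigma_one : Sigma R := delta_mx 0 0.
Definition sigma_y1 : Sigma R := delta_mx 1 0.

Definition mx2 (a b c d : R[i]) : 'M[R[i]]_2 :=
  \matrix_(i, j) (if i == 0 then (if j == 0 then a else b)
                  else (if j == 0 then c else d)).

(* The matrices of e_1, e_2, e_3 in the basis (1, y_1) of Sigma; indices start
   at 0. *)
Definition clifford (k : 'I_3) : 'M[R[i]]_2 :=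
  nth 0 [:: mx2 'i%C 0 0 (- 'i%C);
            mx2 0 'i%C 'i%C 0;
            mx2 0 (-1) 1 0] k.

Lemma cliffordE :
  [/\ clifford 0 *m sigma_one = 'i%C *: sigma_one
      /\ clifford 0 *m sigma_y1 = - 'i%C *: sigma_y1,
      clifford 1 *m sigma_one = 'i%C *: sigma_y1
      /\ clifford 1 *m sigma_y1 = 'i%C *: sigma_one &
      clifford 2 *m sigma_one = sigma_y1
      /\ clifford 2 *m sigma_y1 = - sigma_one].
Proof.
by split; split; apply/matrixP => i j; rewrite !mxE !big_ord_recl big_ord0 !mxE ord1;
  case: i => [[|[|//]]] ? /=; rewrite ?(mulr0, mulr1, addr0, add0r, oppr0).
Qed.

End CliffordModule.

(* Sections of the spinor bundle, which the frame [e] trivialises as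
   [M * Sigma]. *)
Record spinor {R : realType} (M : manifoldType R 3) := Spinor {
  spinor_fun :> M -> Sigma R ;
  spinor_smooth_Re : forall k, smooth (fun p => complex.Re (spinor_fun p k 0)) ;
  spinor_smooth_Im : forall k, smooth (fun p => complex.Im (spinor_fun p k 0)) }.

Section Spinors.
Context {R : realType} {M : manifoldType R 3}.
Variables (g : riemannian_metric M)
  (nabla : vector_field M -> vector_field M -> vector_field M)
  (e : 'I_3 -> vector_field M).

Definition invariant_spinor (psi : spinor M) : Prop :=
  exists s : Sigma R, forall p, psi p = s.

(* [X . psi], where [X = \sum_i g(X, e_i) e_i]. *)
Definition clifford_mul (X : vector_field M) (psi : spinor M) (p : M) : Sigma R :=
  \sum_(i < 3) (g X (e i) p)%:C%C *: (clifford i *m psi p).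

Definition spinor_derivative (X : vector_field M) (psi : spinor M) (p : M) :
    Sigma R :=
  \col_k Complex (X (mk_smooth (spinor_smooth_Re psi k)) p)
                 (X (mk_smooth (spinor_smooth_Im psi k)) p).

(* The lift of [nabla] in the trivialisation by [e]; the derivative vanishes on
   invariant spinors. *)
Definition spin_connection (X : vector_field M) (psi : spinor M) (p : M) :
    Sigma R :=
  spinor_derivative X psi p +
  2^-1 *: \sum_(i < 3) \sum_(j < 3 | (i < j)%N)
    (g (nabla X (e i)) (e j) p)%:C%C *: (clifford i *m (clifford j *m psi p)).

Definition generalised_killing (A : {linear vector_field M -> vector_field M})
    (psi : spinor M) : Prop :=
  (forall X Y, g (A X) Y = g X (A Y)) /\
  (forall X p, spin_connection X psi p = clifford_mul (A X) psi p).

End Spinors.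

(* Main.v *)
(* In dimension three Clifford multiplication by e_i e_j is, up to sign, that by
   the remaining e_k, so on an invariant spinor psi (whose derivative part
   vanishes) the spin connection is Clifford multiplication by a real vector v(X)
   independent of psi. Since v . v . psi = - |v|^2 psi, Clifford multiplication by
   a nonzero real vector is injective; hence v(X) . psi = A(X) . psi with psi
   nonzero forces v(X) = A(X), and the equation holds for all invariant spinors. *)
Require Import Defs.
From mathcomp Require Import all_boot all_order all_algebra.
From mathcomp Require Import complex ring.
From mathcomp Require Import all_classical all_reals all_analysis.
Import Order.TTheory GRing.Theory Num.Theory.
Import numFieldNormedType.Exports.
Local Open Scope classical_set_scope.
Local Open Scope ring_scope.

Lemma sum3 {V : nmodType} (F : 'I_3 -> V) : \sum_i F i = F 0 + F 1 + F 2.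
Proof.
rewrite !big_ord_recl big_ord0 addr0 addrA.
by congr (F _ + F _ + F _); exact: val_inj.
Qed.

Section CliffordAlgebra.
Context {R : realType}.
Implicit Types (v w : 'rV[R]_3) (s : 'cV[R[i]]_2).

Definition clifford_vec v : 'M[R[i]]_2 := \sum_(i < 3) (v 0 i)%:C%C *: clifford i.

Lemma mulmx2 (a b c d a' b' c' d' : R[i]) :
  mx2 a b c d *m mx2 a' b' c' d' =
  mx2 (a * a' + b * c') (a * b' + b * d') (c * a' + d * c') (c * b' + d * d').
Proof.
apply/matrixP => i j; rewrite !mxE !big_ord_recl big_ord0 !mxE addr0.
by case: i => [[|[|//]]] ?; case: j => [[|[|//]]].
Qed.

Lemma oppmx2 (a b c d : R[i]) : - mx2 a b c d = mx2 (- a) (- b) (- c) (- d).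
Proof.
apply/matrixP => i j; rewrite !mxE.
by case: i => [[|[|//]]] ?; case: j => [[|[|//]]].
Qed.

Lemma sqri : 'i%C * 'i%C = -1 :> R[i].
Proof. by rewrite -expr2 sqr_i. Qed.

Lemma clifford01 : clifford 0 *m clifford 1 = clifford 2 :> 'M[R[i]]_2.
Proof. by rewrite mulmx2 mulNr sqri; congr mx2; ring. Qed.

Lemma clifford02 : clifford 0 *m clifford 2 = - clifford 1 :> 'M[R[i]]_2.
Proof. by rewrite mulmx2 oppmx2; congr mx2; ring. Qed.

Lemma clifford12 : clifford 1 *m clifford 2 = clifford 0 :> 'M[R[i]]_2.
Proof. by rewrite mulmx2; congr mx2; ring. Qed.

Lemma clifford_vecE v : clifford_vec v =
  mx2 ('i%C * (v 0 0)%:C%C) ('i%C * (v 0 1)%:C%C - (v 0 2)%:C%C)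
      ('i%C * (v 0 1)%:C%C + (v 0 2)%:C%C) (- ('i%C * (v 0 0)%:C%C)).
Proof.
rewrite /clifford_vec sum3; apply/matrixP => i j; rewrite !mxE.
case: i => [[|[|//]]] ?; case: j => [[|[|//]]] ? /=; ring.
Qed.

Lemma clifford_vec_sqr v : clifford_vec v *m clifford_vec v =
  - (\sum_i v 0 i ^+ 2)%:C%C%:M.
Proof.
have sqrE (a b c : R[i]) :
    mx2 ('i%C * a) ('i%C * b - c) ('i%C * b + c) (- ('i%C * a)) *m
    mx2 ('i%C * a) ('i%C * b - c) ('i%C * b + c) (- ('i%C * a)) =
    - (a ^+ 2 + b ^+ 2 + c ^+ 2)%:M.
  (* The relation ['i * 'i = -1] enters only here; rewriting with [diagE] backwards leaves entries
     that are polynomial identities with ['i] a free variable. *)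
  have diagE : ('i%C * 'i%C) * (a ^+ 2 + b ^+ 2) - c ^+ 2 =
      - (a ^+ 2 + b ^+ 2 + c ^+ 2) by rewrite sqri; ring.
  rewrite mulmx2; apply/matrixP => i j; rewrite !mxE.
  case: i => [[|[|//]]] ?; case: j => [[|[|//]]] ?; rewrite /= ?mulr1n ?mulr0n -?diagE; ring.
by rewrite clifford_vecE sqrE sum3 !rmorphD !rmorphXn.
Qed.

Lemma clifford_vecB v w : clifford_vec (v - w) = clifford_vec v - clifford_vec w.
Proof.
rewrite /clifford_vec -sumrB; apply: eq_bigr => i _.
by rewrite !mxE rmorphB /= scalerBl.
Qed.

(** Real coordinates are essential: a nonzero complex vector whose squares sum to zero acts
    nilpotently, and so kills some nonzero spinor. *)
Lemma clifford_vec_inj s v w : s != 0 ->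
  clifford_vec v *m s = clifford_vec w *m s -> v = w.
Proof.
move=> s0 /eqP; rewrite -subr_eq0 -mulmxBl -clifford_vecB => /eqP vws.
apply/eqP; rewrite -subr_eq0; move: (v - w) vws => u us.
(* Acting by [u] a second time turns [u . s = 0] into [|u|^2 s = 0]. *)
have := congr1 (mulmx (clifford_vec u)) us.
rewrite mulmx0 mulmxA clifford_vec_sqr mulNmx mul_scalar_mx => /eqP.
rewrite oppr_eq0 scaler_eq0 (negPf s0) orbF fmorph_eq0 psumr_eq0; last first.
  by move=> i _; exact: sqr_ge0.
move=> /allP u0; apply/eqP/rowP => i; apply/eqP.
by rewrite [X in _ == X]mxE -sqrf_eq0; apply: u0; rewrite mem_index_enum.
Qed.

End CliffordAlgebra.

(** A derivation kills constants: the Leibniz rule on [1 * 1] gives [X 1 = X 1 + X 1], and linearity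
    does the rest. *)
Lemma vf_cst {R : realType} {n : nat} (M : manifoldType R n) (X : vector_field M)
  (f : smooth_fun M) (a : R) p : (forall q, f q = a) -> X f p = 0.
Proof.
move=> fa; have -> : f = a *: (1 : smooth_fun M).
  by apply: smooth_fun_ext => q; rewrite fa /= -[LHS]mulr1.
have X1 : X 1 = 0.
  have := vf_leibniz X 1 1; rewrite !mulr1 mul1r => /eqP.
  by rewrite -subr_eq0 opprD addNKr oppr_eq0 => /eqP.
(* The scalar [a - 1] is chosen so that [(a - 1) *: 1 + 1 = a *: 1]. *)
have := vf_linear X (a - 1) 1 1.
by rewrite X1 scaler0 addr0 scalerBl scale1r subrK => ->.
Qed.

Section InvariantSpinors.
Context {R : realType} {M : manifoldType R 3}.
Variables (g : riemannian_metric M)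
  (nabla : vector_field M -> vector_field M -> vector_field M)
  (e : 'I_3 -> vector_field M).

(** The vector v(X) of the overview: each connection coefficient [w i j] moves to the index missing
    from [i], [j]. The minus sign comes from [clifford02]. *)
Definition spin_vector (X : vector_field M) (p : M) : 'rV[R]_3 :=
  let w i j := g (nabla X (e i)) (e j) p in
  2^-1 *: \row_k nth 0 [:: w 1 2; - w 0 2; w 0 1] k.

Lemma spinor_derivative_invariant (psi : spinor M) X p :
  invariant_spinor psi -> spinor_derivative X psi p = 0.
Proof.
move=> [s psis]; apply/colP => k; rewrite !mxE.
by congr Complex; [apply: (@vf_cst _ _ _ _ _ (complex.Re (s k 0)))
                  |apply: (@vf_cst _ _ _ _ _ (complex.Im (s k 0)))] => q /=; rewrite psis.
Qed.

Lemma spin_connection_invariant (psi : spinor M) X p : invariant_spinor psi ->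
  spin_connection g nabla e X psi p = clifford_vec (spin_vector X p) *m psi p.
Proof.
move=> /spinor_derivative_invariant dpsi; rewrite /spin_connection dpsi add0r.
(* The condition [i < j] becomes zero terms, so that both sums expand over all three indices. *)
under eq_bigr do rewrite big_mkcond sum3 /=.
rewrite sum3 /= !mulmxA clifford01 clifford02 clifford12 /clifford_vec sum3.
rewrite !mxE /= !rmorphM /= fmorphV rmorph_nat !addr0 !add0r.
rewrite !mulmxDl -!scalemxAl -!scalerA -!scalerDr.
by congr (_ *: _); rewrite mulNmx scalerN rmorphN scaleNr addrC addrA addrAC.
Qed.

Lemma clifford_mulE (psi : spinor M) X p :
  clifford_mul g e X psi p = clifford_vec (\row_i g X (e i) p) *m psi p.
Proof.
rewrite /clifford_vec mulmx_suml; apply: eq_bigr => i _.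
by rewrite mxE -scalemxAl.
Qed.

End InvariantSpinors.

Theorem lemma4p1 (R : realType) (G : lieGroupType R 3) (omega : orientation G)
    (g : riemannian_metric G)
    (nabla : vector_field G -> vector_field G -> vector_field G)
    (e : 'I_3 -> vector_field G)
    (A : {linear vector_field G -> vector_field G}) :
  connected [set: G] ->
  left_invariant_metric g ->
  levi_civita g nabla ->
  (forall i, left_invariant_field (e i)) ->
  orthonormal_frame g e ->
  positively_oriented omega e ->
  (exists psi : spinor G,
    [/\ invariant_spinor psi, exists p, psi p != 0 &
        generalised_killing g nabla e A psi]) ->
  forall phi : spinor G, invariant_spinor phi ->
    generalised_killing g nabla e A phi.
Proof.
move=> _ _ _ _ _ _ [psi [psi_inv [q psi_q] [A_sym psi_kill]]] phi phi_inv.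
split=> // X p; rewrite clifford_mulE spin_connection_invariant //.
(* The vectors acting on [phi p] do not involve [phi], so their equality can be tested on [psi p],
   which is nonzero because [psi] is constant and nonzero at [q]. *)
congr (clifford_vec _ *m _); apply: (@clifford_vec_inj _ (psi p)).
  by case: psi_inv => s psis; move: psi_q; rewrite !psis.
by rewrite -spin_connection_invariant // psi_kill clifford_mulE.
Qed.
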